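(* Let $C$ be a linear second order continuous diffusion process on $G$ and let $R=R(C)$ be the discrete process obtained from $C$ by the randomized rounding scheme, started from the same integral initial load vector. Then for every round $t$ and every node $k$, with high probability $$\left|X^R_k(t)-x^C_k(t)\right|=O\left(\Upsilon^C(G)\cdot\sqrt{d\log n}\right).$$
   Context: $G=(V,E)$ is a finite undirected graph with $V=\{1,\dots,n\}$, $n\ge2$, maximum degree $d$; $N(i)$ is the set of neighbors of $i$. Flow matrices are antisymmetric $n\times n$ matrices vanishing at non-edges; the $(i,j)$ entry is the load sent from $i$ to $j$. A second order process $C$ determines the flow of round $t\ge 1$ as $y^C(t)=C(x^C(t),y^C(t-1))$ from the current load vector and the previous flow; in the very first round $t=0$ a first order scheme is applied, $y_{i,j}(0)=\alpha_{i,j}(x_i(0)/s_i-x_j(0)/s_j)$ with edge parameters $\alpha_{i,j}=\alpha_{j,i}>0$, $\sum_{j\in N(i)}\alpha_{i,j}\le1$, and node speeds $s_i\ge 1$. Loads evolve by $x_i(t+1)=x_i(t)-\sum_{j\in N(i)}y_{i,j}(t)$. $C$ is linear if $C(a\mathbf{x}+b\mathbf{x}',a\mathbf{y}+b\mathbf{y}')=aC(\mathbf{x},\mathbf{y})+bC(\mathbf{x}',\mathbf{y}')$ for all load vectors $\mathbf{x},\mathbf{x}'$, flow matrices $\mathbf{y},\mathbf{y}'$ and $a,b\in\mathbb{R}$. (Main example, SOS: $C(\mathbf{x},\mathbf{y})_{i,j}=(\beta-1)y_{i,j}+\beta\alpha_{i,j}(x_i/s_i-x_j/s_j)$ for $j\in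 N(i)$.) Randomized rounding $R(C)$: in round $t$, let $\hat Y(t)$ be the flow prescribed by the continuous rule applied to the discrete process' own state, i.e. $\hat Y(t)=C(X^R(t),Y^R(t-1))$ for $t\ge1$ and the first order rule applied to $X^R(0)$ for $t=0$. Write $\{a\}=a-\lfloor a\rfloor$. Each node $i$ first rounds down $\hat Y_{i,j}(t)$ for all $j\in N(i)$ with $\hat Y_{i,j}(t)\ge 0$. Let $r=\sum_{j:\hat Y_{i,j}(t)\ge0}\{\hat Y_{i,j}(t)\}$. Node $i$ takes $\lceil r\rceil$ excess tokens; independently, each is sent out with probability $r/\lceil r\rceil$ (otherwise it stays on $i$), and a token that is sent out goes to neighbor $j$ (with $\hat Y_{i,j}(t)\ge 0$) with probability $\{\hat Y_{i,j}(t)\}/r$. With $Z_{i,j}(t)$ the number of excess tokens $i$ sends to $j$, $Y^R_{i,j}(t)=\lfloor\hat Y_{i,j}(t)\rfloor+Z_{i,j}(t)$ if $\hat Y_{i,j}(t)\ge0$ and $Y^R_{i,j}(t)=-Y^R_{j,i}(t)$ otherwise; $X^R_i(t+1)=X^R_i(t)-\sum_{j\in N(i)}Y^R_{i,j}(t)$. Random choices of different nodes and rounds are independent given the current state. Contributions: let $\mathbf{x}(0)=\mathbf{x}'(0)=\hat{\mathbf i}$, $\mathbf{y}(0)=0$, and let $\mathbf{y}'(0)$ be the flow sending one unit from $i$ to $j$ and nothing else, so that $\mathbf{x}(1)=\hat{\mathbf i}$, $\mathbf{x}'(1)=\hat{\mathbf j}$. Let $\mathbf{x}(t+1),\mathbf{x}'(t+1)$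 be the load vectors obtained by applying $C$ for $t$ rounds on $(\mathbf{x}(1),\mathbf{y}(0))$ and $(\mathbf{x}'(1),\mathbf{y}'(0))$. Then $\mathcal{C}^C_{k,i\rightarrow j}(t)=\mathbf{x}_k(t)-\mathbf{x}'_k(t)$. Refined local divergence: $$\Upsilon^{C}(G)=\max_{k\in V}\Big(\sum_{s=0}^{\infty}\sum_{i=1}^n\max_{j\in N(i)}\big(\mathcal{C}^C_{k,i\rightarrow j}(s)\big)^2\Big)^{1/2}.$$ ''With high probability'' means with probability at least $1-n^{-a}$ for some constant $a>0$; the constant in $O(\cdot)$ is absolute. *)

(* Defs.v *)
From HB Require Import structures.
From mathcomp Require Import all_boot all_order all_algebra.
From mathcomp Require Import all_classical all_reals all_analysis.

Set Implicit Arguments.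
Unset Strict Implicit.
Unset Printing Implicit Defensive.

Import Order.TTheory GRing.Theory Num.Theory.

Local Open Scope classical_set_scope.
Local Open Scope ring_scope.

(* A simple graph on n nodes is a symmetric irreflexive [e : rel 'I_n]; load
   vectors are row vectors, and entry (i, j) of a flow matrix is the load sent
   from i to j. *)

Definition max_degree n (e : rel 'I_n) : nat := \max_i #|[set j | e i j]%SET|.

Definition flow_matrix (R : zmodType) n (e : rel 'I_n) (y : 'M[R]_n) : Prop :=
  (forall i j, y j i = - y i j) /\ (forall i j, ~~ e i j -> y i j = 0).

Definition next_load (R : zmodType) n (e : rel 'I_n)
    (x : 'rV[R]_n) (y : 'M[R]_n) : 'rV[R]_n :=
  \row_i (x 0 i - \sum_(j | e i j) y i j).

Section ContinuousProcess.
Variables (R : realType) (n : nat) (e : rel 'I_n).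

Record fos_parameters (alpha : 'I_n -> 'I_n -> R) (speed : 'I_n -> R) : Prop :=
  FosParameters {
    fos_sym : forall i j, e i j -> alpha i j = alpha j i;
    fos_pos : forall i j, e i j -> 0 < alpha i j;
    fos_sum : forall i, \sum_(j | e i j) alpha i j <= 1;
    fos_speed : forall i, 1 <= speed i }.

Definition fos_flow (alpha : 'I_n -> 'I_n -> R) (speed : 'I_n -> R)
    (x : 'rV[R]_n) : 'M[R]_n :=
  \matrix_(i, j)
    if e i j then alpha i j * (x 0 i / speed i - x 0 j / speed j) else 0.

Variable C : 'rV[R]_n -> 'M[R]_n -> 'M[R]_n.

(* [C] is only meaningful on flow matrices; its values elsewhere are junk. *)
Definition flow_valued : Prop :=
  forall x y, flow_matrix e y -> flow_matrix e (C x y).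

Definition linear_process : Prop :=
  forall (a b : R) (x x' : 'rV[R]_n) (y y' : 'M[R]_n),
    flow_matrix e y -> flow_matrix e y' ->
    C (a *: x + b *: x') (a *: y + b *: y') = a *: C x y + b *: C x' y'.

(* One round t >= 1, on the pair (x(t), y(t-1)). *)
Definition second_order_round (st : 'rV[R]_n * 'M[R]_n) : 'rV[R]_n * 'M[R]_n :=
  let y := C st.1 st.2 in (next_load e st.1 y, y).

(* The load x(t) when the initial load is x0 and the flow of round 0 is y0. *)
Definition second_order_load (x0 : 'rV[R]_n) (y0 : 'M[R]_n) (t : nat)
    : 'rV[R]_n :=
  if t is t'.+1 then (iter t' second_order_round (next_load e x0 y0, y0)).1
  else x0.

Definition continuous_load (alpha : 'I_n -> 'I_n -> R) (speed : 'I_n -> R)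
    (x0 : 'rV[R]_n) (t : nat) : 'rV[R]_n :=
  second_order_load x0 (fos_flow alpha speed x0) t.

Definition contribution (k i j : 'I_n) (t : nat) : R :=
  second_order_load (delta_mx 0 i) 0 t 0 k
  - second_order_load (delta_mx 0 i) (delta_mx i j - delta_mx j i) t 0 k.

(* Extended-real valued, as the series may diverge for a general [C].  All the
   terms are nonnegative, so 0 is a neutral default for both maxima; an isolated
   node i contributes 0. *)
Definition refined_local_divergence : \bar R :=
  \big[maxe/0%E]_(k < n)
    sqrte (\sum_(0 <= s <oo)
      (\sum_(i < n) \big[Num.max/0]_(j < n | e i j)
         contribution k i j s ^+ 2)%:E).

End ContinuousProcess.

Section RandomizedRounding.
Variables (R : realType) (n : nat) (e : rel 'I_n).

Definition frac_part (a : R) : R := a - (Num.floor a)%:~R.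

Section OneRound.
Variable Y : 'M[R]_n. (* the prescribed flow \hat Y(t) *)

Definition excess (i : 'I_n) : R :=
  \sum_(j | e i j && (0 <= Y i j)) frac_part (Y i j).

Definition num_tokens (i : 'I_n) : nat := `|Num.ceil (excess i)|%N.

(* The random choices of one round: c (i, m) is what happens to the m-th excess
   token of node i, [Some j] if it is sent to j and [None] if it stays on i.
   There are always enough slots m < n, see [num_tokens_le] below; slots
   m >= num_tokens i correspond to no token and hold [None]. *)
Definition choices := {ffun 'I_n * 'I_n -> option 'I_n}.

Definition token_prob (i m : 'I_n) (dest : option 'I_n) : R :=
  let r := excess i in
  let send := r / (num_tokens i)%:R in
  if (m < num_tokens i)%N then
    match dest with
    | None => 1 - send
    | Some j =>
        if e i j && (0 <= Y i j) then send * (frac_part (Y i j) / r) else 0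
    end
  else (dest == None)%:R.

Definition choices_prob (c : choices) : R :=
  \prod_(i < n) \prod_(m < n) token_prob i m (c (i, m)).

Lemma frac_part_itv (a : R) : 0 <= frac_part a < 1.
Proof.
have := floor_itv a; rewrite intrD /frac_part => /andP[h1 h2].
by rewrite subr_ge0 h1 ltrBlDl.
Qed.

Lemma excess_ge0 (i : 'I_n) : 0 <= excess i.
Proof. by apply: sumr_ge0 => j _; case/andP: (frac_part_itv (Y i j)). Qed.

Lemma num_tokensE (i : 'I_n) : (num_tokens i)%:R = (Num.ceil (excess i))%:~R :> R.
Proof.
rewrite /num_tokens natr_absz ger0_norm // ceil_ge0.
exact: lt_le_trans (excess_ge0 i).
Qed.

Lemma num_tokens_le (i : 'I_n) : (num_tokens i <= n)%N.
Proof.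
rewrite -(ler_nat R) num_tokensE pmulrn ler_int ceil_le_int -pmulrn.
rewrite /excess -[X in _ <= X%:R](card_ord n) -sum1_card natr_sum.
rewrite big_mkcond /=; apply: ler_sum => j _.
by case: ifP => // _; case/andP: (frac_part_itv (Y i j)) => _ /ltW.
Qed.

Lemma token_prob_ge0 (i m : 'I_n) (dest : option 'I_n) :
  0 <= token_prob i m dest.
Proof.
rewrite /token_prob; case: ifP => [hm|_]; last exact: ler0n.
have r0 := excess_ge0 i.
have N0 : 0 < (num_tokens i)%:R :> R by rewrite ltr0n (leq_trans _ hm).
case: dest => [j|]; last first.
  by rewrite subr_ge0 ler_pdivrMr // mul1r num_tokensE ceil_ge.
case: ifP => // _; case/andP: (frac_part_itv (Y i j)) => f0 _.
by rewrite mulr_ge0 // divr_ge0 // ltW.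
Qed.

Lemma token_prob_sum1 (i m : 'I_n) : \sum_dest token_prob i m dest = 1.
Proof.
have sumO (F : option 'I_n -> R) : \sum_d F d = F None + \sum_j F (Some j).
  rewrite (bigD1 None) //=; congr (_ + _).
  rewrite (reindex_omap Some id) => [|[j|]] //=.
  by apply: eq_bigl => j; rewrite eqxx.
rewrite sumO /token_prob; case: ifP => hm; last first.
  by rewrite eqxx big1 ?addr0.
have r0 : excess i != 0.
  by apply: contraTneq hm => r0; rewrite /num_tokens r0 ceil0.
rewrite -big_mkcond /= -mulr_sumr -mulr_suml -/(excess i) divff // mulr1.
exact: subrK.
Qed.

Definition sent_tokens (c : choices) (i j : 'I_n) : nat :=
  #|[set m : 'I_n | (m < num_tokens i)%N && (c (i, m) == Some j)]%SET|.

Definition rounded_flow (c : choices) : 'M[int]_n :=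
  let up i j := Num.floor (Y i j) + (sent_tokens c i j)%:Z in
  \matrix_(i, j)
    if e i j then (if 0 <= Y i j then up i j else - up j i) else 0.

End OneRound.

Variables (alpha : 'I_n -> 'I_n -> R) (speed : 'I_n -> R).
Variable C : 'rV[R]_n -> 'M[R]_n -> 'M[R]_n.

(* The flow prescribed for round t, given the discrete load X(t) and the
   discrete flow Y(t-1) (ignored if t = 0). *)
Definition prescribed_flow (t : nat) (st : 'rV[int]_n * 'M[int]_n) : 'M[R]_n :=
  let X := map_mx intr st.1 in
  if t is 0 then fos_flow e alpha speed X else C X (map_mx intr st.2).

(* The pair (X(t), Y(t-1)) reached from x0 when w s are the choices of round s. *)
Fixpoint discrete_state (x0 : 'rV[int]_n) (w : nat -> choices) (t : nat)
    : 'rV[int]_n * 'M[int]_n :=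
  if t is t'.+1 then
    let st := discrete_state x0 w t' in
    let Y := rounded_flow (prescribed_flow t' st) (w t') in
    (next_load e st.1 Y, Y)
  else (x0, 0).

Definition discrete_load x0 w t : 'rV[int]_n := (discrete_state x0 w t).1.

(* [D t] are the random choices of round t: conditionally on the past, the
   choices of all the tokens of all the nodes are independent, with law
   depending only on the current state. *)
Definition randomized_rounding (disp : measure_display)
    (Omega : measurableType disp) (P : probability Omega R)
    (x0 : 'rV[int]_n) (D : nat -> Omega -> choices) : Prop :=
  (forall t c, measurable [set o | D t o = c]) /\
  forall (t : nat) (w : nat -> choices),
    P [set o | forall s, (s <= t)%N -> D s o = w s] =
    (P [set o | forall s, (s < t)%N -> D s o = w s]
     * (choices_prob (prescribed_flow t (discrete_state x0 w t)) (w t))%:E)%E.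

End RandomizedRounding.

(* Main.v *)
(** If rounding is switched off from round s on, the load of k at time t becomes
    a deterministic function of the state reached at round s.  This prediction
    is a martingale in s, going from the continuous load (s = 0) to the discrete
    one (s = t), and by linearity of C its increment at round s is
    - sum_(i, j) err_(i, j) * contribution_(k, i -> j)(t - s), where err is the
    rounding error.  The increment is a sum over the excess tokens, which are
    independent given the past; node i has at most max_degree of them, each of
    range at most 2 max_j |contribution_(k, i -> j)|.  Bounding exponential
    moments by exp x <= x + exp (2 x^2) instead of Hoeffding's lemma gives
    E exp (l (X - x)) <= exp (8 l^2 V) with V <= max_degree * Upsilon^2, and the
    Chernoff bound at deviation 8 sqrt (V ln n) is 2 / n^2 <= 1 / n.  The case
    V = 0, in which no choice of l is optimal, is treated apart: the prediction
    is then almost surely constant. *)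

Require Import Defs.
From HB Require Import structures.
From mathcomp Require Import all_boot all_order all_algebra.
From mathcomp Require Import all_classical all_reals all_analysis.
From mathcomp Require Import ring lra.

Set Implicit Arguments.
Unset Strict Implicit.
Unset Printing Implicit Defensive.

Import Order.TTheory GRing.Theory Num.Theory.

Local Open Scope classical_set_scope.
Local Open Scope ring_scope.

(** * Exponential moments of bounded centred variables *)

(** For [x > 1/2], [x <= 2 x^2] and monotonicity suffices; for [x <= 1/2],
    [exp x <= 1 / (1 - x) <= 1 + x + 2 x^2]. *)
Lemma expR_le_add_expR_sqr (R : realType) (x : R) :
  expR x <= x + expR (2 * x ^+ 2).
Proof.
have [x2|x2] := lerP x 2^-1; last first.
  have : expR x <= expR (2 * x ^+ 2) by rewrite ler_expR; nra.
  lra.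
have h1 := expR_ge1Dx (2 * x ^+ 2).
have h2 := expR_ge1Dx (- x); rewrite expRN in h2.
have e0 := expR_gt0 x.
have h3 : (1 - x) * expR x <= 1.
  by rewrite -ler_pdivlMr // div1r.
apply: (@le_trans _ _ (x + (1 + 2 * x ^+ 2))); last by rewrite lerD2l.
have x1 : 0 < 1 - x by lra.
rewrite -(ler_pM2l x1); apply: (le_trans h3).
(* [(1 - x) (1 + x + 2 x^2) = 1 + x^2 (1 - 2 x)], which is at least 1 here. *)
by nra.
Qed.

(** The linear term of the pointwise bound averages to zero, so only the quadratic one survives. *)
Lemma mgf_le_of_bounded (R : realType) (T : finType) (p h : T -> R) (B : R) :
  (forall d, 0 <= p d) -> \sum_d p d = 1 -> \sum_d p d * h d = 0 ->
  (forall d, `|h d| <= B) ->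
  \sum_d p d * expR (h d) <= expR (2 * B ^+ 2).
Proof.
move=> p0 p1 ph hB.
apply: (@le_trans _ _ (\sum_d (p d * h d + p d * expR (2 * B ^+ 2)))).
  apply: ler_sum => d _; rewrite -mulrDr ler_wpM2l //.
  apply: (le_trans (expR_le_add_expR_sqr _)); rewrite lerD2l ler_expR.
  rewrite ler_pM2l // -(real_normK (num_real (h d))) lerXn2r ?nnegrE //.
  exact: le_trans (hB d).
by rewrite big_split /= ph add0r -mulr_suml p1 mul1r.
Qed.

Lemma sum_option (V : nmodType) (T : finType) (F : option T -> V) :
  \sum_d F d = F None + \sum_j F (Some j).
Proof.
rewrite (bigD1 None) //=; congr (_ + _).
rewrite (reindex_omap Some id) => [|[j|]] //=.
by apply: eq_bigl => j; rewrite eqxx.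
Qed.

(** * Rounding error as a sum of independent token deviations *)

Section RoundingError.
Variables (R : realType) (n : nat) (e : rel 'I_n) (Y : 'M[R]_n).

(** Each neighbor adds a fractional part below 1 to the excess. This is the source of the factor [d]
    in the bound. *)
Lemma num_tokens_le_degree (i : 'I_n) : (num_tokens e Y i <= max_degree e)%N.
Proof.
apply: (@leq_trans #|[set j | e i j]%SET|); last exact: leq_bigmax.
rewrite -(ler_nat R) num_tokensE pmulrn ler_int ceil_le_int -pmulrn.
rewrite /excess -sum1_card natr_sum big_mkcond [leRHS]big_mkcond /=.
apply: ler_sum => j _; rewrite inE; case: (e i j) => //=.
by case: ifP => // _; case/andP: (frac_part_itv (Y i j)) => _ /ltW.
Qed.

Lemma card_tokens (i : 'I_n) :
  #|(fun m : 'I_n => (m < num_tokens e Y i)%N)| = num_tokens e Y i.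
Proof.
rewrite -sum1_card (eq_bigl (fun m : 'I_n => (m < num_tokens e Y i)%N)) //.
by rewrite -(big_ord_widen _ (fun=> 1%N) (num_tokens_le e Y i)) sum1_card card_ord.
Qed.

Lemma choices_probE (c : choices n) :
  choices_prob e Y c = \prod_p token_prob e Y p.1 p.2 (c p).
Proof. by rewrite /choices_prob pair_bigA; apply: eq_bigr => -[i m]. Qed.

Lemma choices_prob_ge0 (c : choices n) : 0 <= choices_prob e Y c.
Proof. by rewrite choices_probE prodr_ge0 // => p _; exact: token_prob_ge0. Qed.

Lemma choices_prob_sum1 : \sum_c choices_prob e Y c = 1.
Proof.
under eq_bigr do rewrite choices_probE.
rewrite -(bigA_distr_bigA (fun p => token_prob e Y p.1 p.2)) big1 // => p _.
exact: token_prob_sum1.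
Qed.

(** The error is charged to the sending endpoint only; the antisymmetric error of the flow is the
    difference of the two directions. *)
Definition rounding_error (c : choices n) (i j : 'I_n) : R :=
  if e i j && (0 <= Y i j)
  then (sent_tokens e Y c i j)%:R - frac_part (Y i j) else 0.

Section Linear.
Variable v : 'I_n -> 'I_n -> R.

Definition token_value (i : 'I_n) (dest : option 'I_n) : R :=
  if dest is Some j then (if e i j && (0 <= Y i j) then v i j else 0) else 0.

Definition token_mean (i m : 'I_n) : R :=
  \sum_d token_prob e Y i m d * token_value i d.

(** Slots without a token count 0, so that sums and products can run over all slots. *)
Definition token_deviation (i m : 'I_n) (dest : option 'I_n) : R :=
  if (m < num_tokens e Y i)%N then token_value i dest - token_mean i m else 0.

(** Double counting: by destination on the left, by token on the right. *)
Lemma sum_sent_tokens (c : choices n) (i : 'I_n) :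
  \sum_(j | e i j && (0 <= Y i j)) (sent_tokens e Y c i j)%:R * v i j =
  \sum_(m < n | (m < num_tokens e Y i)%N) token_value i (c (i, m)).
Proof.
have -> : \sum_(j | e i j && (0 <= Y i j)) (sent_tokens e Y c i j)%:R * v i j
  = \sum_(j | e i j && (0 <= Y i j))
     \sum_(m < n | (m < num_tokens e Y i)%N) (c (i, m) == Some j)%:R * v i j.
  apply: eq_bigr => j _; rewrite -mulr_suml; congr (_ * _).
  rewrite /sent_tokens -sum1_card natr_sum [LHS]big_mkcond [RHS]big_mkcond /=.
  by apply: eq_bigr => m _; rewrite inE; do 2 case: ifP => //=; case: eqP.
rewrite exchange_big /=; apply: eq_bigr => m _.
rewrite /token_value; case: (c (i, m)) => [j|]; last first.
  by rewrite big1 // => j _; rewrite mul0r.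
rewrite big_mkcond /= (bigD1 j) //= eqxx mul1r big1 ?addr0 // => j' jj'.
case: ifP => // _.
by case: eqP => [[E]|]; rewrite ?mul0r //; rewrite E eqxx in jj'.
Qed.

Lemma excess_eq0 (i : 'I_n) : num_tokens e Y i = 0%N -> excess e Y i = 0.
Proof.
move=> h; have := ceil_ge (excess e Y i).
rewrite -num_tokensE h => r0.
by apply/eqP; rewrite eq_le r0 excess_ge0.
Qed.

(** Rounding is unbiased: each of the [N] tokens reaches [j] with probability
    [(r / N) (f / r) = f / N], where [f] is the fractional part. If [N = 0], all fractional parts
    vanish. *)
Lemma sum_token_mean (i : 'I_n) :
  \sum_(j | e i j && (0 <= Y i j)) frac_part (Y i j) * v i j =
  \sum_(m < n | (m < num_tokens e Y i)%N) token_mean i m.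
Proof.
set N := num_tokens e Y i.
have [N0|N0] := posnP N.
  rewrite [RHS]big_pred0 => [|m]; last by rewrite N0.
  have := excess_eq0 N0; rewrite /excess => /eqP.
  rewrite psumr_eq0 => [/allP h|j _]; last by case/andP: (frac_part_itv (Y i j)).
  apply: big1 => j cj; have := h j (mem_index_enum j).
  by rewrite cj => /eqP ->; rewrite mul0r.
have r0 : excess e Y i != 0.
  apply: contraTneq N0 => r0.
  by rewrite /N /num_tokens r0 ceil0.
have -> : \sum_(m < n | (m < N)%N) token_mean i m =
  \sum_(m < n | (m < N)%N) N%:R^-1 *
     \sum_(j | e i j && (0 <= Y i j)) frac_part (Y i j) * v i j.
  apply: eq_bigr => m mN.
  rewrite /token_mean sum_option /= mulr0 add0r mulr_sumr [RHS]big_mkcond /=.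
  apply: eq_bigr => j _; rewrite /token_prob -/N mN.
  case: ifP => _; last by rewrite mulr0.
  have NR : N%:R != 0 :> R by rewrite pnatr_eq0 -lt0n.
  by field; rewrite r0 NR.
rewrite sumr_const -(mulr_natl _ #|_|) card_tokens.
by rewrite mulrA mulfV ?pnatr_eq0 -?lt0n // mul1r.
Qed.

Lemma sum_rounding_error (c : choices n) :
  \sum_i \sum_j rounding_error c i j * v i j =
  \sum_i \sum_m token_deviation i m (c (i, m)).
Proof.
apply: eq_bigr => i _.
rewrite -[RHS]big_mkcond /= big_split /= sumrN -sum_sent_tokens -sum_token_mean.
rewrite -sumrB [RHS]big_mkcond; apply: eq_bigr => j _.
by rewrite /rounding_error; case: ifP; rewrite ?mul0r // mulrBl.
Qed.

Lemma rounding_error_mgf (M : 'I_n -> R) :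
  (forall i, 0 <= M i) -> (forall i j, e i j -> `|v i j| <= M i) ->
  \sum_c choices_prob e Y c * expR (\sum_i \sum_j rounding_error c i j * v i j)
  <= expR (8 * ((max_degree e)%:R * \sum_i M i ^+ 2)).
Proof.
move=> M0 vM.
pose G (p : 'I_n * 'I_n) d :=
  token_prob e Y p.1 p.2 d * expR (token_deviation p.1 p.2 d).
have -> : \sum_c choices_prob e Y c *
    expR (\sum_i \sum_j rounding_error c i j * v i j) =
    \sum_(c : choices n) \prod_p G p (c p).
  apply: eq_bigr => c _.
  rewrite sum_rounding_error choices_probE pair_bigA expR_sum -big_split /=.
  by apply: eq_bigr => -[i m].
(* Independence of the tokens: the sum over all choice functions factors into one sum per slot. *)
rewrite -bigA_distr_bigA.
have tvM i d : `|token_value i d| <= M i.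
  rewrite /token_value; case: d => [j|]; rewrite ?normr0 ?M0 //.
  by case: ifP => [/andP[eij _]|_]; rewrite ?normr0 ?M0 // vM.
have tmM i m : `|token_mean i m| <= M i.
  apply: (le_trans (ler_norm_sum _ _ _)).
  rewrite -[leRHS]mul1r -(token_prob_sum1 e Y i m) mulr_suml.
  apply: ler_sum => d _; rewrite normrM ger0_norm ?token_prob_ge0 //.
  by rewrite ler_wpM2l ?token_prob_ge0.
apply: (@le_trans _ _ (\prod_(p : 'I_n * 'I_n)
   expR (if (p.2 < num_tokens e Y p.1)%N then 8 * M p.1 ^+ 2 else 0))).
  apply: ler_prod => -[i m] _ /=; apply/andP; split.
    by apply: sumr_ge0 => d _; rewrite mulr_ge0 ?token_prob_ge0 ?expR_ge0.
  rewrite /G /token_deviation /=; case: ifP => mN; last first.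
    by rewrite expR0 -mulr_suml token_prob_sum1 mulr1.
  (* A token value and its mean are both at most [M i] in absolute value, so the deviation is at
     most [2 * M i]. *)
  have -> : 8 * M i ^+ 2 = 2 * (2 * M i) ^+ 2 by ring.
  apply: mgf_le_of_bounded => [d|||d]; first exact: token_prob_ge0.
  - exact: token_prob_sum1.
  - under eq_bigr do rewrite mulrBr.
    by rewrite sumrB -mulr_suml token_prob_sum1 mul1r subrr.
  - apply: (le_trans (ler_normB _ _)).
    by have := tvM i d; have := tmM i m; lra.
rewrite -expR_sum ler_expR -(pair_bigA _ (fun i m : 'I_n =>
  if (m < num_tokens e Y i)%N then 8 * M i ^+ 2 else 0)) /= !mulr_sumr.
apply: ler_sum => i _; rewrite -big_mkcond sumr_const -(mulr_natl _ #|_|).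
rewrite card_tokens.
by rewrite mulrCA ler_pM2l // ler_wpM2r ?sqr_ge0 // ler_nat num_tokens_le_degree.
Qed.

End Linear.
End RoundingError.

(** * Linearity of the continuous process *)

Section LinearProcess.
Variables (R : realType) (n : nat) (e : rel 'I_n).
Variable C : 'rV[R]_n -> 'M[R]_n -> 'M[R]_n.
Hypothesis symE : symmetric e.
Hypotheses (Cflow : flow_valued e C) (Clin : linear_process e C).

Local Notation load := (second_order_load e C).

Lemma flow_matrix0 : flow_matrix e (0 : 'M[R]_n).
Proof. by split=> [i j|i j _]; rewrite !mxE ?oppr0. Qed.

Lemma flow_matrix_lin (a b : R) (y y' : 'M[R]_n) :
  flow_matrix e y -> flow_matrix e y' -> flow_matrix e (a *: y + b *: y').
Proof.
move=> [h1 h2] [h1' h2']; split=> [i j|i j eij]; rewrite !mxE.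
  by rewrite h1 h1'; ring.
by rewrite h2 // h2' // !mulr0 addr0.
Qed.

Lemma next_load_lin (a b : R) (x x' : 'rV[R]_n) (y y' : 'M[R]_n) :
  next_load e (a *: x + b *: x') (a *: y + b *: y') =
  a *: next_load e x y + b *: next_load e x' y'.
Proof.
apply/rowP => i; rewrite !mxE.
under eq_bigr do rewrite !mxE.
by rewrite big_split /= -!mulr_sumr; ring.
Qed.

(** [C] is linear on flow matrices only, so the induction must carry along that both flows stay flow
    matrices. *)
Lemma iter_round_lin (a b : R) (x x' : 'rV[R]_n) (y y' : 'M[R]_n) (m : nat) :
  flow_matrix e y -> flow_matrix e y' ->
  let st := iter m (second_order_round e C) (x, y) in
  let st' := iter m (second_order_round e C) (x', y') in
  [/\ flow_matrix e st.2, flow_matrix e st'.2 &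
      iter m (second_order_round e C) (a *: x + b *: x', a *: y + b *: y') =
      (a *: st.1 + b *: st'.1, a *: st.2 + b *: st'.2)].
Proof.
move=> fy fy'; elim: m => [|m [f f' IH]] //=; rewrite IH /second_order_round /=.
split; [exact: Cflow|exact: Cflow|].
by rewrite Clin // next_load_lin.
Qed.

Lemma second_order_load_lin (a b : R) (x x' : 'rV[R]_n) (y y' : 'M[R]_n) (m : nat) :
  flow_matrix e y -> flow_matrix e y' ->
  load (a *: x + b *: x') (a *: y + b *: y') m =
  a *: load x y m + b *: load x' y' m.
Proof.
move=> fy fy'; case: m => [|m] //=; rewrite next_load_lin.
by case: (iter_round_lin a b (next_load e x y) (next_load e x' y') m fy fy')
  => _ _ ->.
Qed.

Lemma second_order_load_sum (I : Type) (r : seq I) (Q : pred I) (a : I -> R)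
    (y : I -> 'M[R]_n) (m : nat) :
  (forall i, Q i -> flow_matrix e (y i)) ->
  flow_matrix e (\sum_(i <- r | Q i) a i *: y i) /\
  load 0 (\sum_(i <- r | Q i) a i *: y i) m =
    \sum_(i <- r | Q i) a i *: load 0 (y i) m.
Proof.
move=> fy; elim: r => [|i r [f IH]].
  rewrite !big_nil; split; first exact: flow_matrix0.
  (* Linearity with zero coefficients shows that the zero state stays at zero load. *)
  have := second_order_load_lin 0 0 0 0 m flow_matrix0 flow_matrix0.
  by rewrite !scale0r !addr0.
rewrite !big_cons; case: ifP => // Qi.
rewrite -[X in _ *: y i + X]scale1r; split; first exact/flow_matrix_lin/f/fy.
have := second_order_load_lin (a i) 1 0 0 m (fy i Qi) f.
by rewrite !scaler0 addr0 !scale1r IH.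
Qed.

Definition unit_flow (i j : 'I_n) : 'M[R]_n := delta_mx i j - delta_mx j i.

Lemma flow_matrix_unit (i j : 'I_n) : e i j -> flow_matrix e (unit_flow i j).
Proof.
move=> eij; split=> [a b|a b nab]; rewrite !mxE.
  by rewrite opprB andbC [in X in _ - X]andbC.
have -> : (a == i) && (b == j) = false.
  by apply: contraNF nab => /andP[/eqP -> /eqP ->].
have -> : (a == j) && (b == i) = false.
  by apply: contraNF nab => /andP[/eqP -> /eqP ->]; rewrite symE.
by rewrite subr0.
Qed.

(** The two runs share the initial load, so by linearity only the difference of their first flows
    matters. The sign appears because the run with the unit flow is the one subtracted. *)
Lemma contributionE (k i j : 'I_n) (m : nat) : e i j ->
  contribution e C k i j m = - load 0 (unit_flow i j) m 0 k.
Proof.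
move=> eij; rewrite /contribution.
have := second_order_load_lin 1 1 (delta_mx 0 i) 0 m flow_matrix0
  (flow_matrix_unit eij).
by rewrite !scale1r addr0 add0r => ->; rewrite !mxE; ring.
Qed.

(** * Rounding error as a superposition of unit flows *)

Section OneRound.
Variable Y : 'M[R]_n.
Hypothesis Yflow : flow_matrix e Y.
Variable c : choices n.
Hypothesis c_neq0 : choices_prob e Y c != 0.

(** At [Y i j = 0] both endpoints count as senders, and the rounded flow is antisymmetric there only
    because a token takes such an edge with probability 0. *)
Lemma sent_tokens_eq0 (i j : 'I_n) : Y i j = 0 -> sent_tokens e Y c i j = 0%N.
Proof.
move=> Yij; apply/eqP; rewrite cards_eq0; apply/eqP/setP => m; rewrite !inE.
apply/negbTE/negP => /andP[mN /eqP cim].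
move/prodf_neq0: c_neq0 => /(_ i isT) /prodf_neq0 /(_ m isT).
rewrite /token_prob mN cim Yij /frac_part floor0 subrr mul0r mulr0.
by case: ifP; rewrite eqxx.
Qed.

Lemma rounded_flow_err (i j : 'I_n) :
  (rounded_flow e Y c i j)%:~R - Y i j =
  rounding_error e Y c i j - rounding_error e Y c j i.
Proof.
have [antiY offY] := Yflow.
rewrite !mxE /rounding_error (symE j i).
case: ifP => [eij|/negbT eij] /=; last by rewrite offY // subrr.
rewrite (antiY i j); case: (ltrgtP (Y i j) 0) => [Yneg|Ypos|Y0].
- rewrite ltW ?oppr_gt0 // sub0r rmorphN rmorphD /= /frac_part; ring.
- have -> : (0 <= - Y i j) = false by apply/negbTE; rewrite -ltNge oppr_lt0.
  by rewrite rmorphD /= /frac_part; ring.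
- rewrite Y0 oppr0 lexx !sent_tokens_eq0 ?floor0 ?subrr //.
    by rewrite addr0.
  by rewrite antiY Y0 oppr0.
Qed.

Lemma flow_matrix_rounded : flow_matrix e (rounded_flow e Y c).
Proof.
split=> [i j|i j /negbTE eij]; last by rewrite mxE eij.
have [antiY _] := Yflow.
have h : (rounded_flow e Y c j i)%:~R = (- rounded_flow e Y c i j)%:~R :> R.
  have := rounded_flow_err i j; have := rounded_flow_err j i.
  by rewrite (antiY i j) rmorphN /=; lra.
exact: (intr_inj h).
Qed.

Lemma rounding_errorE :
  map_mx intr (rounded_flow e Y c) - Y =
  \sum_(p : 'I_n * 'I_n | e p.1 p.2)
     rounding_error e Y c p.1 p.2 *: unit_flow p.1 p.2.
Proof.
pose Z := \matrix_(i, j) rounding_error e Y c i j.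
have -> : map_mx intr (rounded_flow e Y c) - Y = Z - Z^T.
  by apply/matrixP => i j; rewrite !mxE -rounded_flow_err !mxE.
rewrite {2}(matrix_sum_delta Z) {1}(matrix_sum_delta Z).
rewrite !pair_bigA raddf_sum /= -sumrB [RHS]big_mkcond /=.
apply: eq_bigr => -[i j] _ /=.
rewrite linearZ /= trmx_delta -scalerBr mxE.
by case: ifP => // eij; rewrite /rounding_error eij scale0r.
Qed.

(** By superposition the common initial load cancels and each edge error acts through its own unit
    flow. *)
Lemma load_rounded_flow (x : 'rV[R]_n) (m : nat) (k : 'I_n) :
  load x (map_mx intr (rounded_flow e Y c)) m 0 k - load x Y m 0 k =
  - \sum_i \sum_j rounding_error e Y c i j * contribution e C k i j m.
Proof.
have fu (p : 'I_n * 'I_n) : e p.1 p.2 -> flow_matrix e (unit_flow p.1 p.2).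
  exact: flow_matrix_unit.
have [f hs] := second_order_load_sum (index_enum _)
  (fun p => rounding_error e Y c p.1 p.2) m fu.
have -> : map_mx intr (rounded_flow e Y c) =
    Y + (map_mx intr (rounded_flow e Y c) - Y) by rewrite addrC subrK.
rewrite rounding_errorE.
have := second_order_load_lin 1 1 x 0 m Yflow f.
rewrite !scale1r addr0 => ->; rewrite hs mxE [LHS]addrAC subrr add0r summxE -sumrN.
rewrite big_mkcond /= [in RHS](eq_bigr _ (fun i _ => esym (sumrN _ _ _))).
rewrite pair_bigA; apply: eq_bigr => -[i j] _ /=.
case: ifP => [eij|eij]; last by rewrite /rounding_error eij mul0r oppr0.
by rewrite contributionE // mxE mulrN opprK.
Qed.

End OneRound.

(** * Exponential moment of one round *)

(** The term of index [m] in the series that defines the refined local divergence at node [k]. *)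
Definition round_divergence (k : 'I_n) (m : nat) : R :=
  \sum_(i < n) \big[Num.max/0]_(j < n | e i j) contribution e C k i j m ^+ 2.

Lemma le_round_divergence (k i j : 'I_n) (m : nat) : e i j ->
  contribution e C k i j m ^+ 2 <=
  \big[Num.max/0]_(j < n | e i j) contribution e C k i j m ^+ 2.
Proof.
move=> eij.
exact: (le_bigmax_cond 0 (fun j => contribution e C k i j m ^+ 2) eij).
Qed.

Lemma max_contribution_ge0 (k i : 'I_n) (m : nat) :
  0 <= \big[Num.max/0]_(j < n | e i j) contribution e C k i j m ^+ 2.
Proof. exact: bigmax_ge_id. Qed.

Lemma round_divergence_ge0 (k : 'I_n) (m : nat) : 0 <= round_divergence k m.
Proof. by apply: sumr_ge0 => i _; apply: max_contribution_ge0. Qed.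

Lemma one_round_mgf (Y : 'M[R]_n) (x : 'rV[R]_n) (m : nat) (k : 'I_n) (l : R) :
  flow_matrix e Y ->
  \sum_c choices_prob e Y c *
    expR (l * (load x (map_mx intr (rounded_flow e Y c)) m 0 k - load x Y m 0 k))
  <= expR (8 * l ^+ 2 * ((max_degree e)%:R * round_divergence k m)).
Proof.
move=> fY.
pose v i j := - l * contribution e C k i j m.
pose M i := `|l| * Num.sqrt
  (\big[Num.max/0]_(j < n | e i j) contribution e C k i j m ^+ 2).
have M0 i : 0 <= M i by rewrite mulr_ge0 ?sqrtr_ge0.
have vM i j : e i j -> `|v i j| <= M i.
  move=> eij; rewrite normrM normrN ler_wpM2l // -sqrtr_sqr ler_wsqrtr //.
  exact: le_round_divergence.
have h := rounding_error_mgf Y M0 vM.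
have E : \sum_i M i ^+ 2 = l ^+ 2 * round_divergence k m.
  rewrite mulr_sumr; apply: eq_bigr => i _.
  rewrite exprMn real_normK ?num_real // sqr_sqrtr //.
  exact: max_contribution_ge0.
rewrite -mulrA [l ^+ 2 * _]mulrCA -E; apply: le_trans h.
apply: ler_sum => c _.
(* The error formula holds for choices of positive probability; the others carry weight 0. *)
have [->|c0] := eqVneq (choices_prob e Y c) 0; first by rewrite !mul0r.
rewrite load_rounded_flow // mulrN -mulNr mulr_sumr.
under eq_bigr do rewrite mulr_sumr.
by under eq_bigr do under eq_bigr do rewrite mulrCA.
Qed.

Lemma load_rounded_flow_eq (Y : 'M[R]_n) (c : choices n) (x : 'rV[R]_n)
    (m : nat) (k : 'I_n) :
  flow_matrix e Y -> choices_prob e Y c != 0 ->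
  (max_degree e)%:R * round_divergence k m = 0 ->
  load x (map_mx intr (rounded_flow e Y c)) m 0 k = load x Y m 0 k.
Proof.
move=> fY c0 dB; apply/eqP; rewrite -subr_eq0 load_rounded_flow // oppr_eq0.
apply/eqP/big1 => i _; apply: big1 => j _.
case: (boolP (e i j)) => eij; last by rewrite /rounding_error (negbTE eij) mul0r.
(* The edge [(i, j)] makes the degree positive, so the divergence itself vanishes, and with it every
   contribution along an edge. *)
have d0 : (max_degree e)%:R != 0 :> R.
  rewrite pnatr_eq0 -lt0n; apply: (@leq_trans #|[set j | e i j]%SET|).
    by apply/card_gt0P; exists j; rewrite inE.
  exact: (@leq_bigmax _ (fun i => #|[set j | e i j]%SET|)).
move/eqP: dB; rewrite mulf_eq0 (negbTE d0) psumr_eq0 /= => [/allP h|i' _];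
  last exact: max_contribution_ge0.
have /eqP hi := h i (mem_index_enum i).
have := le_round_divergence k m eij; rewrite hi => h2.
have : contribution e C k i j m ^+ 2 == 0 by rewrite eq_le h2 sqr_ge0.
by rewrite sqrf_eq0 => /eqP ->; rewrite mulr0.
Qed.

End LinearProcess.

(** * States and histories of the discrete process *)

Section DiscreteProcess.
Variables (R : realType) (n : nat) (e : rel 'I_n).
Variables (alpha : 'I_n -> 'I_n -> R) (speed : 'I_n -> R).
Variable C : 'rV[R]_n -> 'M[R]_n -> 'M[R]_n.
Variable x0 : 'rV[int]_n.
Hypothesis symE : symmetric e.
Hypothesis fosP : fos_parameters e alpha speed.
Hypotheses (Cflow : flow_valued e C) (Clin : linear_process e C).

Local Notation load := (second_order_load e C).
Local Notation state := (discrete_state e alpha speed C x0).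
Local Notation prescribed := (prescribed_flow e alpha speed C).

(** Restarting after one round, with the flow [C] prescribes there as first flow, continues the same
    run. *)
Lemma second_order_load_next (x : 'rV[R]_n) (y : 'M[R]_n) (m : nat) :
  load (next_load e x y) (C (next_load e x y) y) m = load x y m.+1.
Proof. by case: m => [|m] //; rewrite /second_order_load iterSr. Qed.

Lemma map_next_load (x : 'rV[int]_n) (y : 'M[int]_n) :
  map_mx intr (next_load e x y) =
  next_load e (map_mx intr x) (map_mx intr y) :> 'rV[R]_n.
Proof.
apply/rowP => i; rewrite !mxE rmorphB rmorph_sum /=.
by congr (_ - _); apply: eq_bigr => j _; rewrite mxE.
Qed.

Lemma flow_matrix_map (y : 'M[int]_n) :
  flow_matrix e y -> flow_matrix e (map_mx intr y : 'M[R]_n).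
Proof.
move=> [h1 h2]; split=> [i j|i j /h2 eij]; rewrite !mxE; last by rewrite eij.
by rewrite h1 rmorphN.
Qed.

Lemma flow_matrix_fos (x : 'rV[R]_n) : flow_matrix e (fos_flow e alpha speed x).
Proof.
split=> [i j|i j /negbTE eij]; rewrite !mxE; last by rewrite eij.
rewrite (symE j i); case: ifP => [eij|_]; last by rewrite oppr0.
by rewrite (fos_sym fosP eij); ring.
Qed.

Lemma flow_matrix_prescribed (s : nat) (st : 'rV[int]_n * 'M[int]_n) :
  flow_matrix e st.2 -> flow_matrix e (prescribed s st).
Proof.
case: s => [|s] h; first exact: flow_matrix_fos.
exact/Cflow/flow_matrix_map.
Qed.

(** Histories are infinite sequences of which only a prefix matters; this extends the prefix of
    length [s] by [c]. *)
Definition override (w : nat -> choices n) (s : nat) (c : choices n) :=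
  fun r => if r == s then c else w r.

Lemma discrete_state_ext (w w' : nat -> choices n) (s : nat) :
  (forall r, (r < s)%N -> w r = w' r) -> state w s = state w' s.
Proof.
elim: s => [//|s IH] h /=.
by rewrite IH ?h // => r rs; apply: h; exact: ltnW.
Qed.

Lemma discrete_state_override (w : nat -> choices n) (s : nat) (c : choices n) :
  state (override w s c) s = state w s.
Proof.
by apply: discrete_state_ext => r rs; rewrite /override ltn_eqF.
Qed.

Definition round_prob (w : nat -> choices n) (s : nat) : choices n -> R :=
  choices_prob e (prescribed s (state w s)).

Lemma flow_matrix_next (w : nat -> choices n) (s : nat) (c : choices n) :
  flow_matrix e (state w s).2 -> round_prob w s c != 0 ->
  flow_matrix e (state (override w s c) s.+1).2.
Proof.
move=> f c0 /=; rewrite discrete_state_override /override eqxx.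
exact/flow_matrix_rounded/c0/flow_matrix_prescribed.
Qed.

(** * A supermartingale inequality on the tree of histories *)

Section PrefixMeasure.
Variables (disp : measure_display) (Omega : measurableType disp).
Variables (P : probability Omega R) (D : nat -> Omega -> choices n).
Hypothesis PD : randomized_rounding e alpha speed C P x0 D.

Definition prefix_event (s : nat) (w : nat -> choices n) : set Omega :=
  [set o | forall r, (r < s)%N -> D r o = w r].

Lemma prefix_event0 (w : nat -> choices n) : prefix_event 0 w = setT.
Proof. by apply/seteqP; split. Qed.

Lemma prefix_eventS (s : nat) (w : nat -> choices n) (c : choices n) :
  prefix_event s.+1 (override w s c) = prefix_event s w `&` [set o | D s o = c].
Proof.
apply/seteqP; split=> o /=.
  move=> h; split=> [r rs|].
    by rewrite h ?ltnS 1?ltnW // /override ltn_eqF.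
  by rewrite h // /override eqxx.
move=> [h1 h2] r; rewrite ltnS leq_eqVlt /override => /orP[/eqP ->|rs].
  by rewrite eqxx.
by rewrite ltn_eqF // h1.
Qed.

Lemma measurable_prefix_event (s : nat) (w : nat -> choices n) :
  measurable (prefix_event s w).
Proof.
elim: s => [|s IH]; first by rewrite prefix_event0.
have -> : prefix_event s.+1 w = prefix_event s w `&` [set o | D s o = w s].
  rewrite -prefix_eventS; apply/seteqP; split=> o h r rs.
    by rewrite h // /override; case: eqP => [->|].
  by rewrite h // /override; case: eqP => [->|].
by apply: measurableI => //; exact: PD.1.
Qed.

Lemma prob_prefix_eventS (s : nat) (w : nat -> choices n) (c : choices n) :
  P (prefix_event s.+1 (override w s c)) =
  (P (prefix_event s w) * (round_prob w s c)%:E)%E.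
Proof.
have := PD.2 s (override w s c).
rewrite discrete_state_override.
have -> : override w s c s = c by rewrite /override eqxx.
move=> E.
rewrite /prefix_event /round_prob.
have -> : [set o | forall r, (r < s)%N -> D r o = w r] =
          [set o | forall r, (r < s)%N -> D r o = override w s c r].
  by apply/seteqP; split=> o h r rs; rewrite h // /override ltn_eqF.
exact: E.
Qed.

Lemma setI_prefix_event (s : nat) (w : nat -> choices n) (B : set Omega) :
  prefix_event s w `&` B =
  \bigcup_(c in [set: choices n]) (prefix_event s.+1 (override w s c) `&` B).
Proof.
apply/seteqP; split=> [z [h Bz]|z [c _ [hz Bz]]].
  by exists (D s z) => //; split=> //; rewrite prefix_eventS.
by move: hz; rewrite prefix_eventS; case.
Qed.

(** [B] is decided by the first [t] choices. Backward induction, with [m] rounds left, writes the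
    set as a finite union over the next choice. *)
Lemma measurable_setI_prefix_event (t : nat) (B : set Omega) :
  (forall w, prefix_event t w `<=` B \/ prefix_event t w `<=` ~` B) ->
  forall m w, (m <= t)%N -> measurable (prefix_event (t - m) w `&` B).
Proof.
move=> tB; elim=> [|m IH] w mt.
  rewrite subn0; case: (tB w) => h.
    by rewrite (setIidl h); exact: measurable_prefix_event.
  by rewrite (_ : _ `&` _ = set0) // disjoints_subset.
rewrite setI_prefix_event; apply: fin_bigcup_measurable; first exact: finite_finset.
by move=> c _; rewrite -subSn // subSS; apply: IH; exact: ltnW.
Qed.

(* The supermartingale inequality can be asked along histories of positive
   probability only: on the others a rounded flow need not be antisymmetric. *)
Lemma prob_setI_prefix_event_le (t : nat) (B : set Omega)
    (U : nat -> (nat -> choices n) -> R) :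
  (forall w, prefix_event t w `<=` B \/ prefix_event t w `<=` ~` B) ->
  (forall s w, 0 <= U s w) ->
  (forall w o, prefix_event t w o -> B o -> 1 <= U t w) ->
  (forall s w, (s < t)%N -> flow_matrix e (state w s).2 ->
     \sum_c round_prob w s c * U s.+1 (override w s c) <= U s w) ->
  forall m w, (m <= t)%N -> flow_matrix e (state w (t - m)).2 ->
    (P (prefix_event (t - m) w `&` B) <=
     P (prefix_event (t - m) w) * (U (t - m)%N w)%:E)%E.
Proof.
move=> tB U0 UB Ustep; elim=> [|m IH] w mt fw.
  rewrite subn0; case: (tB w) => h; last first.
    have -> : prefix_event t w `&` B = set0 by rewrite disjoints_subset.
    by rewrite measure0 mule_ge0 // lee_fin.
  rewrite (setIidl h); have [->|/set0P[z wz]] := eqVneq (prefix_event t w) set0.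
    by rewrite measure0 mul0e.
  by rewrite lee_pemulr // lee_fin (UB w z) //; exact: h.
set s := (t - m.+1)%N.
have sE : s.+1 = (t - m)%N by rewrite /s -subSn.
have st : (s < t)%N by rewrite sE leq_subr.
rewrite setI_prefix_event measure_fin_bigcup; first last.
- by move=> c _; rewrite sE; exact: measurable_setI_prefix_event (ltnW mt).
- move=> c c' _ _ [z [[hz _] [hz' _]]].
  by move: hz hz'; rewrite !prefix_eventS => -[_ <-] [_ <-].
- exact: finite_finset.
have -> : [set: choices n] = [set` xpredT] by apply/seteqP.
rewrite -(@bigfs _ _ _ _ (index_enum (choices n))) ?index_enum_uniq //;
  last by move=> c _; rewrite mem_index_enum.
apply: (@le_trans _ _ (\sum_c P (prefix_event s w) *
    (round_prob w s c * U s.+1 (override w s c))%:E)%E).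
  apply: lee_sum => c _.
  rewrite EFinM muleA -prob_prefix_eventS.
  (* Along a null choice both sides are 0; otherwise the next flow is again a flow matrix and the
     induction hypothesis applies. *)
  have [c0|c0] := eqVneq (round_prob w s c) 0.
    have P0 : P (prefix_event s.+1 (override w s c)) = 0%E.
      by rewrite prob_prefix_eventS c0 mule0.
    rewrite P0 mul0e -P0; apply: le_measure; rewrite ?inE.
    + by rewrite sE; exact: measurable_setI_prefix_event (ltnW mt).
    + exact: measurable_prefix_event.
    + exact: subIsetl.
  have := IH (override w s c) (ltnW mt); rewrite -sE; apply.
  exact: flow_matrix_next.
rewrite -ge0_sume_distrr; last first.
  by move=> c _; rewrite lee_fin mulr_ge0 ?choices_prob_ge0.
by rewrite lee_wpmul2l // sumEFin lee_fin; exact: Ustep.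
Qed.

(** The previous inequality at the root of the tree, where the prefix event is the whole space and
    the stored flow is 0. It is Markov's inequality for [U], without conditional expectations. *)
Lemma prob_le_supermartingale (t : nat) (B : set Omega)
    (U : nat -> (nat -> choices n) -> R) (w : nat -> choices n) :
  (forall w, prefix_event t w `<=` B \/ prefix_event t w `<=` ~` B) ->
  (forall s w, 0 <= U s w) ->
  (forall w o, prefix_event t w o -> B o -> 1 <= U t w) ->
  (forall s w, (s < t)%N -> flow_matrix e (state w s).2 ->
     \sum_c round_prob w s c * U s.+1 (override w s c) <= U s w) ->
  measurable B /\ (P B <= (U 0 w)%:E)%E.
Proof.
move=> tB U0 UB Ustep.
have := measurable_setI_prefix_event tB w (leqnn t).
have := prob_setI_prefix_event_le tB U0 UB Ustep (leqnn t).
rewrite subnn => /(_ w); rewrite prefix_event0 setTI probability_setT mul1e.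
by move=> h mB; split=> //; apply: h; split=> *; rewrite !mxE ?oppr0.
Qed.

End PrefixMeasure.
End DiscreteProcess.

(** * Deviation of the discrete load from the continuous one *)

Section Deviation.
Variables (R : realType) (n : nat) (e : rel 'I_n).
Variables (alpha : 'I_n -> 'I_n -> R) (speed : 'I_n -> R).
Variable C : 'rV[R]_n -> 'M[R]_n -> 'M[R]_n.
Variable x0 : 'rV[int]_n.
Hypothesis symE : symmetric e.
Hypothesis fosP : fos_parameters e alpha speed.
Hypotheses (Cflow : flow_valued e C) (Clin : linear_process e C).
Variables (disp : measure_display) (Omega : measurableType disp).
Variables (P : probability Omega R) (D : nat -> Omega -> choices n).
Hypothesis PD : randomized_rounding e alpha speed C P x0 D.
Variables (t : nat) (k : 'I_n).

Local Notation load := (second_order_load e C).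
Local Notation state := (discrete_state e alpha speed C x0).
Local Notation prescribed := (prescribed_flow e alpha speed C).
Local Notation prob := (round_prob e alpha speed C x0).
Local Notation xC :=
  (continuous_load e C alpha speed (map_mx intr x0) t 0 k).

(* The load of k at time t if rounding stops after round s - 1: a martingale in
   s, from the continuous load at s = 0 to the discrete one at s = t. *)
Definition predicted_load (s : nat) (w : nat -> choices n) : R :=
  load (map_mx intr (state w s).1) (prescribed s (state w s)) (t - s) 0 k.

Lemma predicted_load0 (w : nat -> choices n) : predicted_load 0 w = xC.
Proof. by rewrite /predicted_load subn0. Qed.

Lemma predicted_load_final (w : nat -> choices n) :
  predicted_load t w = (discrete_load e alpha speed C x0 w t 0 k)%:~R.
Proof. by rewrite /predicted_load subnn mxE. Qed.

(** Rewrites the next prediction with the start and horizon of the current one, so that the two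
    differ only by the rounded flow in place of the prescribed one. *)
Lemma predicted_load_next (s : nat) (w : nat -> choices n) (c : choices n) :
  (s < t)%N ->
  predicted_load s.+1 (override w s c) =
  load (map_mx intr (state w s).1)
    (map_mx intr (rounded_flow e (prescribed s (state w s)) c)) (t - s) 0 k.
Proof.
move=> st; rewrite /predicted_load /= discrete_state_override /override eqxx.
by rewrite map_next_load second_order_load_next -subSn // subSS.
Qed.

(** Round [r] acts with index [t - r]; over the rounds from [s] to [t - 1] the index runs from
    [t - s] down to 1, hence [m.+1]. *)
Definition remaining_variance (s : nat) : R :=
  \sum_(m < t - s) (max_degree e)%:R * round_divergence e C k m.+1.

Lemma remaining_varianceS (s : nat) : (s < t)%N ->
  remaining_variance s =
  remaining_variance s.+1 + (max_degree e)%:R * round_divergence e C k (t - s).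
Proof.
move=> st; rewrite /remaining_variance -[(t - s)%N]prednK ?subn_gt0 //.
by rewrite big_ord_recr /= -subnS.
Qed.

Lemma remaining_variance_ge0 (s : nat) : 0 <= remaining_variance s.
Proof. by apply: sumr_ge0 => m _; rewrite mulr_ge0 ?round_divergence_ge0. Qed.

(** The shrinking variance term pays for the exponential moment of each round, which makes this a
    supermartingale. *)
Definition exp_deviation (l : R) (s : nat) (w : nat -> choices n) : R :=
  expR (l * (predicted_load s w - xC) + 8 * l ^+ 2 * remaining_variance s).

Lemma exp_deviation_step (l : R) (s : nat) (w : nat -> choices n) :
  (s < t)%N -> flow_matrix e (state w s).2 ->
  \sum_c prob w s c * exp_deviation l s.+1 (override w s c)
  <= exp_deviation l s w.
Proof.
move=> st fw; rewrite /exp_deviation (remaining_varianceS st).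
set A := l * (predicted_load s w - xC) + 8 * l ^+ 2 * remaining_variance s.+1.
have fY := flow_matrix_prescribed symE fosP Cflow s fw.
have h := one_round_mgf symE Cflow Clin
  (map_mx intr (state w s).1) (t - s) k l fY.
rewrite [8 * _ * (_ + _)]mulrDr addrA -/A expRD.
apply: le_trans (ler_wpM2l (expR_ge0 A) h); rewrite [leRHS]mulr_sumr.
apply: ler_sum => c _; rewrite [leRHS]mulrCA -expRD predicted_load_next //.
rewrite le_eqVlt; apply/orP; left; apply/eqP; congr (_ * expR _).
by rewrite /A /predicted_load; ring.
Qed.

Variable Q : 'rV[int]_n -> Prop.

(** Being a condition on the load at time [t], it is decided by the first [t] choices. *)
Definition final_event : set Omega :=
  [set o | Q (discrete_load e alpha speed C x0 (fun s => D s o) t)].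

Lemma prefix_final_load (w : nat -> choices n) (o : Omega) :
  prefix_event D t w o ->
  discrete_load e alpha speed C x0 (fun s => D s o) t =
  discrete_load e alpha speed C x0 w t.
Proof.
by move=> h; rewrite /discrete_load (@discrete_state_ext _ _ _ _ _ _ _ _ w).
Qed.

Lemma final_event_prefix (w : nat -> choices n) :
  prefix_event D t w `<=` final_event \/ prefix_event D t w `<=` ~` final_event.
Proof.
have [q|q] := pselect (Q (discrete_load e alpha speed C x0 w t)).
  by left=> o /prefix_final_load; rewrite /final_event /= => ->.
by right=> o /prefix_final_load; rewrite /final_event /= => ->.
Qed.

Lemma deviation_tail (l d : R) : 0 <= l ->
  (forall X, Q X -> d < `|(X 0 k)%:~R - xC|) ->
  measurable final_event /\
  (P final_event <= (2 * expR (8 * l ^+ 2 * remaining_variance 0 - l * d))%:E)%E.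
Proof.
move=> l0 Qd.
(* Both signs of [l] cover both tails; the prefactor makes [U] at least 1 on the event. *)
pose U s w := expR (- (l * d)) * (exp_deviation l s w + exp_deviation (- l) s w).
(* An arbitrary history: [U] at time 0 does not depend on it. *)
pose w0 : nat -> choices n := fun=> [ffun=> None].
have -> : 2 * expR (8 * l ^+ 2 * remaining_variance 0 - l * d) = U 0%N w0.
  rewrite /U /exp_deviation predicted_load0 subrr !mulr0 !add0r sqrrN expRD; ring.
apply: (prob_le_supermartingale symE fosP Cflow PD).
- exact: final_event_prefix.
- by move=> s w; rewrite mulr_ge0 ?addr_ge0 ?expR_ge0.
- move=> w o /prefix_final_load E; rewrite /final_event /= E => /Qd.
  rewrite /U /exp_deviation predicted_load_final.
  have -> : remaining_variance t = 0 by rewrite /remaining_variance subnn big_ord0.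
  rewrite !mulr0 !addr0 mulrDr -!expRD; set z := _ - xC => dz.
  have [z0|z0] := lerP 0 z.
    rewrite ger0_norm // in dz.
    rewrite -[leLHS]addr0 lerD ?expR_ge0 // -expR0 ler_expR; nra.
  rewrite ltr0_norm // in dz.
  rewrite -[leLHS]add0r lerD ?expR_ge0 // -expR0 ler_expR; nra.
- move=> s w st fw; rewrite /U.
  under eq_bigr do rewrite mulrCA mulrDr.
  rewrite -mulr_sumr ler_wpM2l ?expR_ge0 // big_split /=.
  by apply: lerD; exact: exp_deviation_step.
Qed.

Lemma predicted_load_step_eq (s : nat) (w : nat -> choices n) (c : choices n) :
  remaining_variance 0 = 0 -> (s < t)%N -> flow_matrix e (state w s).2 ->
  prob w s c != 0 -> predicted_load s.+1 (override w s c) = predicted_load s w.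
Proof.
move=> V0 st fw c0; rewrite predicted_load_next //.
apply: load_rounded_flow_eq => //; first exact: flow_matrix_prescribed.
move/eqP: V0; rewrite psumr_eq0 => [/allP h|m _]; last first.
  by rewrite mulr_ge0 ?round_divergence_ge0.
(* The summand of round [s] has summation index [(t - s).-1], because of the shift in
   [remaining_variance]. *)
have ts : ((t - s).-1 < t - 0)%N.
  by rewrite subn0 -subnS ltn_subrL (leq_ltn_trans _ st).
have := h (Ordinal ts) (mem_index_enum _).
by rewrite /= prednK ?subn_gt0 // => /eqP.
Qed.

(** The indicator that the prediction differs from [xC] serves as supermartingale: it starts at 0
    and is constant along choices of positive probability. *)
Lemma deviation_null : remaining_variance 0 = 0 ->
  (forall X, Q X -> (X 0 k)%:~R != xC) ->
  measurable final_event /\ (P final_event <= 0)%E.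
Proof.
move=> V0 Qd.
pose U s w : R := (predicted_load s w != xC)%:R.
pose w0 : nat -> choices n := fun=> [ffun=> None].
have <- : (U 0%N w0)%:E = 0%E by rewrite /U predicted_load0 eqxx.
apply: (prob_le_supermartingale symE fosP Cflow PD).
- exact: final_event_prefix.
- by move=> s w; exact: ler0n.
- move=> w o /prefix_final_load E; rewrite /final_event /= E => /Qd.
  by rewrite /U predicted_load_final => ->.
- move=> s w st fw.
  have -> : \sum_c prob w s c * U s.+1 (override w s c) =
            \sum_c prob w s c * U s w.
    apply: eq_bigr => c _.
    have [->|c0] := eqVneq (prob w s c) 0; first by rewrite !mul0r.
    by rewrite /U predicted_load_step_eq.
  by rewrite -mulr_suml choices_prob_sum1 mul1r.
Qed.

Lemma sqrt_sum_le_divergence :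
  ((Num.sqrt (\sum_(m < t) round_divergence e C k m.+1))%:E <=
   refined_local_divergence e C)%E.
Proof.
apply: le_trans (le_bigmax_cond _ _ (isT : xpredT k)).
pose S := \sum_(m < t) round_divergence e C k m.+1.
have -> : (Num.sqrt S)%:E = sqrte S%:E by [].
have B0 m : (0 <= (round_divergence e C k m)%:E)%E.
  by rewrite lee_fin round_divergence_ge0.
rewrite lee_sqrt; last by apply: nneseries_ge0 => m _ _; exact: B0.
(* The first [t.+1] terms include index 0, which is then dropped as nonnegative. *)
apply: le_trans (nneseries_lim_ge t.+1 _) => [|m _ _]; last exact: B0.
rewrite sumEFin lee_fin big_mkord big_ord_recl /= lerDr.
exact: round_divergence_ge0.
Qed.

End Deviation.

(** * Choice of constants and the final bound *)

Theorem mainTheorem9 (R : realType) :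
  exists a K : R, [/\ 0 < a, 0 < K &
    forall (n : nat) (e : rel 'I_n)
      (alpha : 'I_n -> 'I_n -> R) (speed : 'I_n -> R)
      (C : 'rV[R]_n -> 'M[R]_n -> 'M[R]_n)
      (x0 : 'rV[int]_n)
      (disp : measure_display) (Omega : measurableType disp)
      (P : probability Omega R) (D : nat -> Omega -> choices n),
      (2 <= n)%N -> symmetric e -> irreflexive e ->
      fos_parameters e alpha speed ->
      flow_valued e C -> linear_process e C ->
      randomized_rounding e alpha speed C P x0 D ->
      forall (t : nat) (k : 'I_n),
        let XR (o : Omega) : R :=
          (discrete_load e alpha speed C x0 (fun s => D s o) t 0 k)%:~R in
        let xC : R :=
          continuous_load e C alpha speed (map_mx intr x0) t 0 k in
        ((1 - n%:R `^ (- a))%:E <=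
         P [set o | (`|XR o - xC|%:E <=
             K%:E * refined_local_divergence e C
             * (Num.sqrt ((max_degree e)%:R * ln n%:R))%:E)%E])%E].
Proof.
exists 1, 8; split=> // n e alpha speed C x0 disp Omega P D n2 symE _ fosP
  Cflow Clin PD t k; cbv zeta.
set xC := continuous_load _ _ _ _ _ _ _ _.
set r := (8%:E * _ * _)%E.
pose S : R := \sum_(m < t) round_divergence e C k m.+1.
have S0 : 0 <= S by apply: sumr_ge0 => m _; exact: round_divergence_ge0.
have n1 : 1 < n%:R :> R by rewrite ltr1n.
have n0 : 0 < n%:R :> R by lra.
have ln0 : 0 < ln n%:R :> R by exact: ln_gt0.
pose V := remaining_variance e C t k 0.
have VE : V = (max_degree e)%:R * S.
  by rewrite /V /remaining_variance subn0 -mulr_sumr.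
pose d := 8 * Num.sqrt (V * ln n%:R).
(* The divergence may be infinite, so the real threshold [d], built from the first rounds only, is
   compared with [r] in the extended reals. *)
have dr : (d%:E <= r)%E.
  have -> : d%:E = (8%:E * (Num.sqrt S)%:E *
      (Num.sqrt ((max_degree e)%:R * ln n%:R))%:E)%E.
    rewrite -!EFinM -(mulrA 8) -sqrtrM // /d VE.
    by congr ((8 * Num.sqrt _)%:E); ring.
  rewrite /r; apply: lee_wpmul2r; first by rewrite lee_fin sqrtr_ge0.
  by apply: lee_wpmul2l; [rewrite lee_fin | exact: sqrt_sum_le_divergence].
pose Q (X : 'rV[int]_n) := ~ (`|(X 0 k)%:~R - xC|%:E <= r)%E.
have Qd X : Q X -> d < `|(X 0 k)%:~R - xC|.
  move=> /negP; rewrite -ltNge => h.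
  by rewrite -lte_fin; exact: le_lt_trans h.
have [mB PB] : measurable (final_event e alpha speed C x0 D t Q) /\
    (P (final_event e alpha speed C x0 D t Q) <= (n%:R `^ (- 1))%:E)%E.
  have [V0|V0] := eqVneq V 0.
    have [|mB PB] := deviation_null symE fosP Cflow Clin PD (Q := Q) V0.
      move=> X /Qd; rewrite -subr_eq0 -normr_gt0; apply: le_lt_trans.
      by rewrite mulr_ge0 // sqrtr_ge0.
    by split=> //; apply: (le_trans PB); rewrite lee_fin powR_ge0.
  have Vp : 0 < V by rewrite lt_def V0 remaining_variance_ge0.
  (* [l = d / (16 V)] minimizes [8 l^2 V - l d]; the minimum is [- d^2 / (32 V) = - 2 ln n]. *)
  have l0 : 0 <= d / (16 * V).
    by rewrite divr_ge0 ?mulr_ge0 ?sqrtr_ge0 // ltW.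
  have [mB PB] := deviation_tail symE fosP Cflow Clin PD l0 Qd.
  split=> //; apply: (le_trans PB); rewrite lee_fin powR_inv1 ?(ltW n0) // -/V.
  have -> : 8 * (d / (16 * V)) ^+ 2 * V - d / (16 * V) * d = - (2 * ln n%:R).
    have -> : 8 * (d / (16 * V)) ^+ 2 * V - d / (16 * V) * d
              = - (d ^+ 2 / (32 * V)) by field.
    rewrite /d exprMn sqr_sqrtr ?mulr_ge0 ?ltW //; field.
    exact: V0.
  rewrite expRN expRM_natl lnK ?posrE // -exprVn.
  (* What remains is [2 / n^2 <= 1 / n], which holds as [n >= 2]. *)
  have u0 : 0 < n%:R^-1 :> R by rewrite invr_gt0.
  have u2 : 2 * n%:R^-1 <= 1 :> R.
    by rewrite ler_pdivrMr // mul1r (ler_nat _ 2).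
  nra.
have -> : [set o |
    (`|(discrete_load e alpha speed C x0 (D^~ o) t 0 k)%:~R - xC|%:E <= r)%E] =
    ~` final_event e alpha speed C x0 D t Q.
  by apply/seteqP; split=> o /=; rewrite /final_event /Q /= notK.
rewrite probability_setC //.
by rewrite EFinB leeB.
Qed.
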